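(* For any sentence $A$ and any contexts of sentences $\Gamma$ and $\Delta$, the following hold in the universal classical Kripke model $\mathcal U$: \begin{align*} (\Gamma,\Delta):\Vdash A &\ \Longrightarrow\ \Gamma\vdash A\mid\Delta \text{ is derivable in } \mathrm{LK}_{\mu\tilde\mu},\\ (\Gamma,\Delta):A\Vdash &\ \Longrightarrow\ \Gamma\mid A\vdash\Delta \text{ is derivable in } \mathrm{LK}_{\mu\tilde\mu}. \end{align*} Moreover, the derivations on the right-hand sides are cut-free (i.e. there exist cut-free derivations of these sequents).
   Context: Formulae are those of first-order predicate logic over the connectives $\top,\bot,\wedge,\vee,\to,\exists,\forall$, in a language with infinitely many constants. A sentence is a formula without free variables; $\neg A$ abbreviates $A\to\bot$. The metatheory is constructive. **The calculus $\mathrm{LK}_{\mu\tilde\mu}$.** Contexts $\Gamma,\Delta$ are finite sets of formulae; a comma denotes union/adjunction. Sequents have the forms $\Gamma\vdash\Delta$, $\Gamma\mid A\vdash\Delta$, $\Gamma\vdash A\mid\Delta$. Rules (premises $\Rightarrow$ conclusion): - $(\mathrm{Ax}_L)$: $\Gamma\mid A\vdash A,\Delta$; $(\mathrm{Ax}_R)$: $A,\Gamma\vdash A\mid\Delta$. - $(\tilde\mu)$: $\Gamma,A\vdash\Delta\Rightarrow\Gamma\mid A\vdash\Delta$; $(\mu)$: $\Gamma\vdash A,\Delta\Rightarrow\Gamma\vdash A\mid\Delta$. - $(\to_L)$: $\Gamma\vdash A\mid\Delta$ and $\Gamma\mid B\vdash\Delta\Rightarrow\Gamma\mid A\to B\vdash\Delta$;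 $(\to_R)$: $\Gamma,A\vdash B\mid\Delta\Rightarrow\Gamma\vdash A\to B\mid\Delta$. - $(\vee_L)$: $\Gamma\mid A\vdash\Delta$ and $\Gamma\mid B\vdash\Delta\Rightarrow\Gamma\mid A\vee B\vdash\Delta$; $(\vee_R^1)$: $\Gamma\vdash A\mid\Delta\Rightarrow\Gamma\vdash A\vee B\mid\Delta$; $(\vee_R^2)$: $\Gamma\vdash B\mid\Delta\Rightarrow\Gamma\vdash A\vee B\mid\Delta$. - $(\wedge_L^1)$: $\Gamma\mid A\vdash\Delta\Rightarrow\Gamma\mid A\wedge B\vdash\Delta$; $(\wedge_L^2)$: $\Gamma\mid B\vdash\Delta\Rightarrow\Gamma\mid A\wedge B\vdash\Delta$; $(\wedge_R)$: $\Gamma\vdash A\mid\Delta$ and $\Gamma\vdash B\mid\Delta\Rightarrow\Gamma\vdash A\wedge B\mid\Delta$. - $(\exists_L)$: $\Gamma\mid A(x)\vdash\Delta$, $x$ fresh $\Rightarrow\Gamma\mid\exists x.A(x)\vdash\Delta$; $(\exists_R)$: $\Gamma\vdash A(t)\mid\Delta\Rightarrow\Gamma\vdash\exists x.A(x)\mid\Delta$. - $(\forall_L)$: $\Gamma\mid A(t)\vdash\Delta\Rightarrow\Gamma\mid\forall x.A(x)\vdash\Delta$; $(\forall_R)$: $\Gamma\vdash A(x)\mid\Delta$, $x$ fresh $\Rightarrow\Gamma\vdash\forall x.A(x)\mid\Delta$. - $(\bot_L)$: $\Gamma\mid\bot\vdash\Delta$; $(\top_R)$: $\Gamma\vdash\top\mid\Delta$.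 - $(\mathrm{Cut})$: $\Gamma\vdash A\mid\Delta$ and $\Gamma\mid A\vdash\Delta\Rightarrow\Gamma\vdash\Delta$. Here $t$ is any term and ''$x$ fresh'' means that $x$ is not free in the conclusion. A derivation is *cut-free* (normal) if in every instance of (Cut) one premise is an axiom $(\mathrm{Ax}_L)$ or $(\mathrm{Ax}_R)$ and the other premise is an axiom or the conclusion of an introduction rule (that is, of a rule other than $(\mu)$, $(\tilde\mu)$). **The universal model $\mathcal U$.** It is given by $(K,\le,D,\Vdash_s,\Vdash_\bot)$ where: $K$ is the set of pairs $(\Gamma,\Delta)$ of contexts of $\mathrm{LK}_{\mu\tilde\mu}$ (the worlds); $(\Gamma,\Delta)\le(\Gamma',\Delta')$ iff $\Gamma\subseteq\Gamma'$ and $\Delta\subseteq\Delta'$; for atomic sentences $X$, $(\Gamma,\Delta):X\Vdash_s$ (''$X$ is strongly refuted'') iff $\Gamma\mid X\vdash\Delta$ has a cut-free derivation; $(\Gamma,\Delta)\Vdash_\bot$ (''exploding'') iff $\Gamma\vdash\Delta$ has a cut-free derivation; and $D(w)$ is the set of closed terms, for every $w\in K$ (a closed term, as an element of $D(w)$, is named by itself). Strong refutation is extended to composite sentences by induction, simultaneously with forcing and refutation: - $w:\Vdash A$ ($A$ is forced in $w$) iff every $w'\ge w$ with $w':A\Vdash_s$ is exploding; - $w:A\Vdash$ ($A$ is refuted in $w$) iff every $w'\ge w$ with $w':\Vdash A$ is exploding; - $w:A\wedge B\Vdash_s$ iff $w:A\Vdash$ or $w:B\Vdash$; - $w:A\vee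 B\Vdash_s$ iff $w:A\Vdash$ and $w:B\Vdash$; - $w:A\to B\Vdash_s$ iff $w:\Vdash A$ and $w:B\Vdash$; - $w:\forall x.A(x)\Vdash_s$ iff $w:A(d)\Vdash$ for some $d\in D(w)$; - $w:\exists x.A(x)\Vdash_s$ iff for all $w'\ge w$ and $d\in D(w')$, $w':A(d)\Vdash$; - $w:\bot\Vdash_s$ always; $w:\top\Vdash_s$ never. *)

(* Defs.v *)
From HB Require Import structures.
From mathcomp Require Import all_boot finmap.

Set Implicit Arguments.
Unset Strict Implicit.
Unset Printing Implicit Defensive.

Local Open Scope fset_scope.

Record language := Language {
  fun_sym : choiceType;
  fun_arity : fun_sym -> nat;
  pred_sym : choiceType;
  pred_arity : pred_sym -> nat
}.

(* Constants are the function symbols of arity 0; there are infinitely many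
   when no finite list contains all of them. *)
Definition infinitely_many_constants (L : language) : Prop :=
  forall s : seq (fun_sym L),
    exists2 c : fun_sym L, fun_arity c = 0 & c \notin s.

(* De Bruijn syntax: [Var k] below [n] quantifiers is bound by the [k]-th
   enclosing one if [k < n], and is the free variable number [k - n] otherwise.
   Formulae are thus taken up to renaming of bound variables. *)
Inductive term (L : language) : Type :=
| Var of nat
| App (f : fun_sym L) of {ffun 'I_(fun_arity f) -> term L}.

Inductive form (L : language) : Type :=
| Atom (P : pred_sym L) of {ffun 'I_(pred_arity P) -> term L}
| Top
| Bot
| And of form L & form L
| Or of form L & form L
| Imp of form L & form L
| Ex of form L
| All of form L.

Arguments Var {L}.
Arguments Top {L}.
Arguments Bot {L}.

(* Encodings into generic trees, which only serve to equip [term L] and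
   [form L] with choiceType structures, as {fset _} requires. *)
Section Encoding.
Variable L : language.

Fixpoint term_encode (t : term L) : GenTree.tree (nat + fun_sym L) :=
  match t with
  | Var n => GenTree.Leaf (inl n)
  | App f a => GenTree.Node 0
      (GenTree.Leaf (inr f) ::
         [seq term_encode (a i) | i <- enum 'I_(fun_arity f)])
  end.

Fixpoint term_decode (t : GenTree.tree (nat + fun_sym L)) : term L :=
  match t with
  | GenTree.Leaf (inl n) => Var n
  | GenTree.Node 0 (GenTree.Leaf (inr f) :: s) =>
      App [ffun i : 'I_(fun_arity f) => nth (Var 0) (map term_decode s) i]
  | _ => Var 0
  end.

Lemma term_encodeK : cancel term_encode term_decode.
Proof.
rewrite /cancel; fix IH 1; case=> [n|f a] //=.
congr App; apply/ffunP => i; rewrite ffunE -map_comp.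
by rewrite (nth_map i) ?size_enum_ord //= nth_ord_enum IH.
Qed.

HB.instance Definition _ := Choice.copy (term L) (can_type term_encodeK).

Fixpoint form_encode (A : form L) : GenTree.tree (pred_sym L + term L) :=
  match A with
  | Atom P a => GenTree.Node 0
      (GenTree.Leaf (inl P) ::
         [seq GenTree.Leaf (inr (a i)) | i <- enum 'I_(pred_arity P)])
  | Top => GenTree.Node 1 [::]
  | Bot => GenTree.Node 2 [::]
  | And A B => GenTree.Node 3 [:: form_encode A; form_encode B]
  | Or A B => GenTree.Node 4 [:: form_encode A; form_encode B]
  | Imp A B => GenTree.Node 5 [:: form_encode A; form_encode B]
  | Ex A => GenTree.Node 6 [:: form_encode A]
  | All A => GenTree.Node 7 [:: form_encode A]
  end.

Definition leaf_term (t : GenTree.tree (pred_sym L + term L)) : term L :=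
  if t is GenTree.Leaf (inr u) then u else Var 0.

Fixpoint form_decode (t : GenTree.tree (pred_sym L + term L)) : form L :=
  match t with
  | GenTree.Node 0 (GenTree.Leaf (inl P) :: s) =>
      Atom [ffun i : 'I_(pred_arity P) => nth (Var 0) (map leaf_term s) i]
  | GenTree.Node 2 _ => Bot
  | GenTree.Node 3 [:: A; B] => And (form_decode A) (form_decode B)
  | GenTree.Node 4 [:: A; B] => Or (form_decode A) (form_decode B)
  | GenTree.Node 5 [:: A; B] => Imp (form_decode A) (form_decode B)
  | GenTree.Node 6 [:: A] => Ex (form_decode A)
  | GenTree.Node 7 [:: A] => All (form_decode A)
  | _ => Top
  end.

Lemma form_encodeK : cancel form_encode form_decode.
Proof.
elim=> [P a|||A IA B IB|A IA B IB|A IA B IB|A IA|A IA] //=; rewrite ?IA ?IB //.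
congr Atom; apply/ffunP => i; rewrite ffunE -map_comp.
by rewrite (nth_map i) ?size_enum_ord //= nth_ord_enum.
Qed.

HB.instance Definition _ := Choice.copy (form L) (can_type form_encodeK).

End Encoding.

Section Syntax.
Variable L : language.
Implicit Types (t : term L) (A B : form L) (s : nat -> term L).

Fixpoint free_in_term (x : nat) t : bool :=
  match t with
  | Var y => x == y
  | App f a => has (fun i => free_in_term x (a i)) (enum 'I_(fun_arity f))
  end.

Fixpoint free_in (x : nat) A : bool :=
  match A with
  | Atom P a => [exists i, free_in_term x (a i)]
  | Top | Bot => false
  | And A B | Or A B | Imp A B => free_in x A || free_in x B
  | Ex A | All A => free_in x.+1 A
  end.

Definition closed_term t : Prop := forall x, ~~ free_in_term x t.
Definition sentence A : Prop := forall x, ~~ free_in x A.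

Fixpoint subst_term s t : term L :=
  match t with
  | Var x => s x
  | App f a => App [ffun i => subst_term s (a i)]
  end.

Definition up s : nat -> term L :=
  fun x => if x is y.+1 then subst_term (fun z => Var z.+1) (s y) else Var 0.

Fixpoint subst s A : form L :=
  match A with
  | Atom P a => Atom [ffun i => subst_term s (a i)]
  | Top => Top
  | Bot => Bot
  | And A B => And (subst s A) (subst s B)
  | Or A B => Or (subst s A) (subst s B)
  | Imp A B => Imp (subst s A) (subst s B)
  | Ex A => Ex (subst (up s) A)
  | All A => All (subst (up s) A)
  end.

(* If [A] is the body of a quantified formula [Ex A] or [All A], then
   [inst A t] is its instance A(t): index 0 is replaced by [t] and the free
   variables are renumbered, as they leave the scope of the quantifier. *)
Definition inst A t : form L :=
  subst (fun x => if x is y.+1 then Var y else t) A.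

Definition ctx := {fset form L}.

Definition fresh_for (x : nat) (G : ctx) : Prop :=
  forall B, B \in G -> ~~ free_in x B.

Inductive sequent : Type :=
| Seq of ctx & ctx               (* G |- D *)
| SeqL of ctx & form L & ctx     (* G | A |- D *)
| SeqR of ctx & form L & ctx.    (* G |- A | D *)

Inductive deriv : sequent -> Type :=
| AxL G A D : deriv (SeqL G A (A |` D))
| AxR G A D : deriv (SeqR (A |` G) A D)
| MuT G A D : deriv (Seq (A |` G) D) -> deriv (SeqL G A D)
| Mu G A D : deriv (Seq G (A |` D)) -> deriv (SeqR G A D)
| ImpL G A B D : deriv (SeqR G A D) -> deriv (SeqL G B D) ->
    deriv (SeqL G (Imp A B) D)
| ImpR G A B D : deriv (SeqR (A |` G) B D) -> deriv (SeqR G (Imp A B) D)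
| OrL G A B D : deriv (SeqL G A D) -> deriv (SeqL G B D) ->
    deriv (SeqL G (Or A B) D)
| OrR1 G A B D : deriv (SeqR G A D) -> deriv (SeqR G (Or A B) D)
| OrR2 G A B D : deriv (SeqR G B D) -> deriv (SeqR G (Or A B) D)
| AndL1 G A B D : deriv (SeqL G A D) -> deriv (SeqL G (And A B) D)
| AndL2 G A B D : deriv (SeqL G B D) -> deriv (SeqL G (And A B) D)
| AndR G A B D : deriv (SeqR G A D) -> deriv (SeqR G B D) ->
    deriv (SeqR G (And A B) D)
| ExL x G A D : fresh_for x G -> ~~ free_in x (Ex A) -> fresh_for x D ->
    deriv (SeqL G (inst A (Var x)) D) -> deriv (SeqL G (Ex A) D)
| ExR t G A D : deriv (SeqR G (inst A t) D) -> deriv (SeqR G (Ex A) D)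
| AllL t G A D : deriv (SeqL G (inst A t) D) -> deriv (SeqL G (All A) D)
| AllR x G A D : fresh_for x G -> ~~ free_in x (All A) -> fresh_for x D ->
    deriv (SeqR G (inst A (Var x)) D) -> deriv (SeqR G (All A) D)
| BotL G D : deriv (SeqL G Bot D)
| TopR G D : deriv (SeqR G Top D)
| Cut G A D : deriv (SeqR G A D) -> deriv (SeqL G A D) -> deriv (Seq G D).

Definition ends_with_axiom S (p : deriv S) : bool :=
  match p with AxL _ _ _ | AxR _ _ _ => true | _ => false end.

Definition ends_with_intro S (p : deriv S) : bool :=
  match p with
  | AxL _ _ _ | AxR _ _ _ | MuT _ _ _ _ | Mu _ _ _ _ | Cut _ _ _ _ _ => false
  | _ => true
  end.

Definition normal_cut S S' (p : deriv S) (q : deriv S') : bool :=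
  (ends_with_axiom p && (ends_with_axiom q || ends_with_intro q)) ||
  (ends_with_axiom q && (ends_with_axiom p || ends_with_intro p)).

Fixpoint cutfree S (p : deriv S) : bool :=
  match p with
  | AxL _ _ _ | AxR _ _ _ | BotL _ _ | TopR _ _ => true
  | MuT _ _ _ p | Mu _ _ _ p | ImpR _ _ _ _ p | OrR1 _ _ _ _ p
  | OrR2 _ _ _ _ p | AndL1 _ _ _ _ p | AndL2 _ _ _ _ p
  | ExL _ _ _ _ _ _ _ p | ExR _ _ _ _ p | AllL _ _ _ _ p
  | AllR _ _ _ _ _ _ _ p => cutfree p
  | ImpL _ _ _ _ p q | OrL _ _ _ _ p q | AndR _ _ _ _ p q =>
      cutfree p && cutfree q
  | Cut _ _ _ p q => [&& normal_cut p q, cutfree p & cutfree q]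
  end.

Definition cutfree_derivable (S : sequent) : Prop :=
  exists p : deriv S, cutfree p.

End Syntax.

Section UniversalModel.
Variable L : language.
Implicit Types (A B : form L) (d : term L).

Definition world : Type := (ctx L * ctx L)%type.
Implicit Types w : world.

Definition wle w w' : Prop := (w.1 `<=` w'.1) /\ (w.2 `<=` w'.2).

Definition dom w : term L -> Prop := @closed_term L.

Definition exploding w : Prop := cutfree_derivable (Seq w.1 w.2).

(* Forcing and refutation determined by a strong refutation predicate. *)
Definition forced_by (sr : world -> Prop) w : Prop :=
  forall w', wle w w' -> sr w' -> exploding w'.

Definition refuted_by (sr : world -> Prop) w : Prop :=
  forall w', wle w w' -> forced_by sr w' -> exploding w'.

Fixpoint height A : nat :=
  match A with
  | Atom _ _ | Top | Bot => 0
  | And A B | Or A B | Imp A B => (maxn (height A) (height B)).+1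
  | Ex A | All A => (height A).+1
  end.

(* The instance A(d) is not a subterm of the quantified formula, so the
   induction on formulae is on [n], an upper bound on the height; see the
   equations below. *)
Fixpoint srefuted_rec (n : nat) A w {struct n} : Prop :=
  match A, n with
  | Atom _ _, _ => cutfree_derivable (SeqL w.1 A w.2)
  | Top, _ => False
  | Bot, _ => True
  | And A B, n.+1 =>
      refuted_by (srefuted_rec n A) w \/ refuted_by (srefuted_rec n B) w
  | Or A B, n.+1 =>
      refuted_by (srefuted_rec n A) w /\ refuted_by (srefuted_rec n B) w
  | Imp A B, n.+1 =>
      forced_by (srefuted_rec n A) w /\ refuted_by (srefuted_rec n B) w
  | All A, n.+1 =>
      exists d, dom w d /\ refuted_by (srefuted_rec n (inst A d)) w
  | Ex A, n.+1 =>
      forall w' d, wle w w' -> dom w' d ->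
        refuted_by (srefuted_rec n (inst A d)) w'
  | _, 0 => False
  end.

Definition srefuted w A : Prop := srefuted_rec (height A) A w.
Definition forced w A : Prop := forced_by (srefuted^~ A) w.
Definition refuted w A : Prop := refuted_by (srefuted^~ A) w.

Lemma forcedE w A :
  forced w A <-> (forall w', wle w w' -> srefuted w' A -> exploding w').
Proof. by []. Qed.

Lemma refutedE w A :
  refuted w A <-> (forall w', wle w w' -> forced w' A -> exploding w').
Proof. by []. Qed.

Lemma height_subst s A : height (subst s A) = height A.
Proof.
by elim: A s => //= [A IA B IB|A IA B IB|A IA B IB|A IA|A IA] s;
  rewrite ?IA ?IB.
Qed.

Lemma height_inst A d : height (inst A d) = height A.
Proof. exact: height_subst. Qed.

Lemma forced_by_iff (sr sr' : world -> Prop) :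
  (forall w, sr w <-> sr' w) -> forall w, forced_by sr w <-> forced_by sr' w.
Proof.
by move=> E w; split=> F w' ww' /E; apply: F.
Qed.

Lemma refuted_by_iff (sr sr' : world -> Prop) :
  (forall w, sr w <-> sr' w) -> forall w, refuted_by sr w <-> refuted_by sr' w.
Proof.
by move=> E w; split=> F w' ww' /(forced_by_iff E); apply: F.
Qed.

Lemma srefuted_rec_irrel n m A w :
  height A <= n -> height A <= m -> srefuted_rec n A w <-> srefuted_rec m A w.
Proof.
elim: n m A w => [|n IH] [|m] [P a|||A B|A B|A B|A|A] w //=;
  rewrite ?ltnS ?geq_max.
- move=> /andP[nA nB] /andP[mA mB].
  have EA := refuted_by_iff (fun v => IH m A v nA mA).
  have EB := refuted_by_iff (fun v => IH m B v nB mB).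
  by split=> -[/EA|/EB]; [left|right|left|right].
- move=> /andP[nA nB] /andP[mA mB].
  have EA := refuted_by_iff (fun v => IH m A v nA mA).
  have EB := refuted_by_iff (fun v => IH m B v nB mB).
  by split=> -[/EA ? /EB].
- move=> /andP[nA nB] /andP[mA mB].
  have EA := forced_by_iff (fun v => IH m A v nA mA).
  have EB := refuted_by_iff (fun v => IH m B v nB mB).
  by split=> -[/EA ? /EB].
- move=> nA mA.
  have E d := refuted_by_iff (fun v => IH m (inst A d) v
    (leq_trans (eq_leq (height_inst A d)) nA)
    (leq_trans (eq_leq (height_inst A d)) mA)).
  by split=> F w' d ww' wd; apply/E; apply: F.
- move=> nA mA.
  have E d := refuted_by_iff (fun v => IH m (inst A d) v
    (leq_trans (eq_leq (height_inst A d)) nA)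
    (leq_trans (eq_leq (height_inst A d)) mA)).
  by split=> -[d [wd /E]]; exists d.
Qed.

Lemma srefuted_AtomE w P a :
  srefuted w (Atom (P := P) a) <-> cutfree_derivable (SeqL w.1 (Atom a) w.2).
Proof. by []. Qed.

Lemma srefuted_TopE w : srefuted w Top <-> False.
Proof. by []. Qed.

Lemma srefuted_BotE w : srefuted w Bot <-> True.
Proof. by []. Qed.

Lemma srefuted_AndE w A B : srefuted w (And A B) <-> refuted w A \/ refuted w B.
Proof.
have EA := refuted_by_iff (fun v => @srefuted_rec_irrel _ (height A) A v
  (leq_maxl _ (height B)) (leqnn _)).
have EB := refuted_by_iff (fun v => @srefuted_rec_irrel _ (height B) B v
  (leq_maxr (height A) _) (leqnn _)).
by split=> -[/EA|/EB]; [left|right|left|right].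
Qed.

Lemma srefuted_OrE w A B : srefuted w (Or A B) <-> refuted w A /\ refuted w B.
Proof.
have EA := refuted_by_iff (fun v => @srefuted_rec_irrel _ (height A) A v
  (leq_maxl _ (height B)) (leqnn _)).
have EB := refuted_by_iff (fun v => @srefuted_rec_irrel _ (height B) B v
  (leq_maxr (height A) _) (leqnn _)).
by split=> -[/EA ? /EB].
Qed.

Lemma srefuted_ImpE w A B : srefuted w (Imp A B) <-> forced w A /\ refuted w B.
Proof.
have EA := forced_by_iff (fun v => @srefuted_rec_irrel _ (height A) A v
  (leq_maxl _ (height B)) (leqnn _)).
have EB := refuted_by_iff (fun v => @srefuted_rec_irrel _ (height B) B v
  (leq_maxr (height A) _) (leqnn _)).
by split=> -[/EA ? /EB].
Qed.

Lemma srefuted_AllE w A :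
  srefuted w (All A) <-> exists d, dom w d /\ refuted w (inst A d).
Proof.
have E d := refuted_by_iff (fun v => @srefuted_rec_irrel _ _ (inst A d) v
  (eq_leq (height_inst A d)) (leqnn _)).
by split=> -[d [wd /E]]; exists d.
Qed.

Lemma srefuted_ExE w A :
  srefuted w (Ex A) <->
  (forall w' d, wle w w' -> dom w' d -> refuted w' (inst A d)).
Proof.
have E d := refuted_by_iff (fun v => @srefuted_rec_irrel _ _ (inst A d) v
  (eq_leq (height_inst A d)) (leqnn _)).
by split=> F w' d ww' wd; apply/E; apply: F.
Qed.

End UniversalModel.

(* Main.v *)
Require Import Defs.
From mathcomp Require Import all_boot finmap.

(** Completeness of the universal model is proved by induction on the height
    of [A], for all worlds at once, in three simultaneous claims ([reify],
    [reify_srefuted_refuted]): forcing yields a cut-free derivation of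
    [G |- A | D], refutation one of [G | A |- D], and strong refutation one
    of [G | A |- D] as well.

    The claim on strong refutation is read off the left introduction rules.
    It carries the claim on refutation: let [G'], containing [A], be the left
    context of a world that strongly refutes [A]; cutting the derivation of
    [G' | A |- D'] against the axiom [G' |- A | D'] gives [G' |- D'], so the
    world explodes. Hence [A] is forced as soon as it is in the left context
    ([forced_hyp]); a world refuting [A] therefore explodes once [A] is added
    on its left, and rule (mu~) concludes. The cuts so created are normal,
    since a derivation ending with (mu~) need not be cut at all: its premise is
    already the sequent wanted ([explode_left], [explode_right]).

    In the claim on forcing, [And], [Imp] and [All] are introduced by their
    right rules: a world that strongly refutes a component also refutes it
    ([srefuted_refuted]), so the component inherits forcing from the compound;
    for [Imp], this holds once the antecedent is on the left, where it is forced.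
    For [Or] and [Ex] no disjunct or witness is at hand; as for atoms and
    [Bot], the formula is added on the right, where it is strongly refuted, so
    that the world explodes, and rule (mu) concludes ([forced_explode]).

    For the eigenvariable rules, the model only speaks of closed terms: one
    instantiates with a constant [c] that occurs nowhere in the sequent, and
    then replaces [c] by a fresh variable throughout the derivation. This, and
    the weakening behind the monotonicity of strong refutation, are instances
    of one transformation of derivations, [deriv_replace], which replaces
    variables and constants by terms and enlarges the contexts. *)

Set Implicit Arguments.
Unset Strict Implicit.
Unset Printing Implicit Defensive.

Local Open Scope fset_scope.

(** * Simultaneous replacement of variables and function symbols *)

Section Replacement.
Variable L : language.
Implicit Types (t u : term L) (A B : form L) (s : nat -> term L).
Implicit Types (k : fun_sym L -> option (term L)).

(** The generated scheme has no induction hypothesis for the arguments, which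
    are nested in a finite function. *)
Lemma term_nested_ind (P : term L -> Prop) :
    (forall n, P (Var n)) ->
    (forall f (a : {ffun 'I_(fun_arity f) -> term L}),
       (forall i, P (a i)) -> P (App a)) ->
  forall t, P t.
Proof. by move=> PV PA; fix IH 1; case=> [n|f a]; [apply: PV | apply: PA]. Qed.

(** A symbol sent to [Some u] is replaced, together with its arguments, by [u];
    only constants are so replaced below. Substitution is the case where no
    symbol is replaced, so that one composition law covers every use. *)
Fixpoint replace_term k s t : term L :=
  match t with
  | Var x => s x
  | App f a => if k f is Some u then u
               else App [ffun i => replace_term k s (a i)]
  end.

Definition shift_term : term L -> term L := subst_term (fun x => Var x.+1).

Definition up_sym k : fun_sym L -> option (term L) :=
  fun f => omap shift_term (k f).

Fixpoint replace k s A : form L :=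
  match A with
  | Atom P a => Atom [ffun i => replace_term k s (a i)]
  | Top => Top
  | Bot => Bot
  | And A B => And (replace k s A) (replace k s B)
  | Or A B => Or (replace k s A) (replace k s B)
  | Imp A B => Imp (replace k s A) (replace k s B)
  | Ex A => Ex (replace (up_sym k) (up s) A)
  | All A => All (replace (up_sym k) (up s) A)
  end.

Definition no_sym : fun_sym L -> option (term L) := fun=> None.

Lemma eq_replace_term k k' s s' t :
    k =1 k' -> (forall x, free_in_term x t -> s x = s' x) ->
  replace_term k s t = replace_term k' s' t.
Proof.
move=> kk'; elim/term_nested_ind: t => [n|f a IH] ss' /=; first exact/ss'/eqxx.
rewrite -kk'; case: (k f) => //; congr App; apply/ffunP=> i; rewrite !ffunE.
apply: IH => x xi; apply: ss' => /=.
by apply/hasP; exists i; rewrite ?mem_enum.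
Qed.

Lemma eq_replace k k' s s' A :
    k =1 k' -> (forall x, free_in x A -> s x = s' x) ->
  replace k s A = replace k' s' A.
Proof.
have eq_up v v' B :
    (forall x, free_in x.+1 B -> v x = v' x) ->
  forall x, free_in x B -> up v x = up v' x.
  by move=> vv' [|x] //= xB; rewrite vv'.
have eq_up_sym (l l' : fun_sym L -> option (term L)) :
  l =1 l' -> up_sym l =1 up_sym l' by move=> ll' f; rewrite /up_sym ll'.
elim: A k k' s s' => //= [P a|A IA B IB|A IA B IB|A IA B IB|A IA|A IA]
  k k' s s' kk' ss'.
- congr Atom; apply/ffunP=> i; rewrite !ffunE.
  by apply: eq_replace_term => // x xi; apply: ss'; apply/existsP; exists i.
- by rewrite (IA k k' s s') ?(IB k k' s s') // => x xA; apply: ss';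
    rewrite xA ?orbT.
- by rewrite (IA k k' s s') ?(IB k k' s s') // => x xA; apply: ss';
    rewrite xA ?orbT.
- by rewrite (IA k k' s s') ?(IB k k' s s') // => x xA; apply: ss';
    rewrite xA ?orbT.
- by congr Ex; apply: IA; [exact: eq_up_sym | exact: eq_up].
- by congr All; apply: IA; [exact: eq_up_sym | exact: eq_up].
Qed.

Lemma replace_term_no_sym s t : replace_term no_sym s t = subst_term s t.
Proof.
elim/term_nested_ind: t => //= f a IH.
by congr App; apply/ffunP=> i; rewrite !ffunE.
Qed.

Lemma replace_no_sym s A : replace no_sym s A = subst s A.
Proof.
elim: A s => //= [P a|A IA B IB|A IA B IB|A IA B IB|A IA|A IA] s;
  rewrite ?IA ?IB //.
by congr Atom; apply/ffunP=> i; rewrite !ffunE replace_term_no_sym.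
Qed.

Lemma replace_term_id t : replace_term no_sym Var t = t.
Proof.
elim/term_nested_ind: t => //= f a IH.
by congr App; apply/ffunP=> i; rewrite !ffunE.
Qed.

Lemma replace_id A : replace no_sym Var A = A.
Proof.
have up_id B : replace (up_sym no_sym) (up Var) B = replace no_sym Var B.
  by apply: eq_replace => // -[].
elim: A => //= [P a|A IA B IB|A IA B IB|A IA B IB|A IA|A IA];
  rewrite ?up_id ?IA ?IB //.
by congr Atom; apply/ffunP=> i; rewrite !ffunE replace_term_id.
Qed.

Definition comp_sym k s k' : fun_sym L -> option (term L) :=
  fun f => if k' f is Some u then Some (replace_term k s u) else k f.

Lemma replace_term_comp k s k' s' t :
  replace_term k s (replace_term k' s' t) =
  replace_term (comp_sym k s k') (fun x => replace_term k s (s' x)) t.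
Proof.
elim/term_nested_ind: t => //= f a IH; rewrite /comp_sym.
case: (k' f) => //=; case: (k f) => //.
by congr App; apply/ffunP=> i; rewrite !ffunE IH.
Qed.

Lemma replace_shift_term k s t :
  replace_term (up_sym k) (up s) (shift_term t) =
  shift_term (replace_term k s t).
Proof.
rewrite /shift_term -!replace_term_no_sym !replace_term_comp.
apply: eq_replace_term => [f|x _] /=.
  by rewrite /comp_sym /up_sym; case: (k f) => //= u; rewrite replace_term_no_sym.
by rewrite replace_term_no_sym.
Qed.

Lemma replace_comp k s k' s' A :
  replace k s (replace k' s' A) =
  replace (comp_sym k s k') (fun x => replace_term k s (s' x)) A.
Proof.
have up_comp v v' (l l' : fun_sym L -> option (term L)) B :
    replace (comp_sym (up_sym l) (up v) (up_sym l'))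
            (fun x => replace_term (up_sym l) (up v) (up v' x)) B =
    replace (up_sym (comp_sym l v l')) (up (fun x => replace_term l v (v' x))) B.
  apply: eq_replace => [f|[|x] _] //=; last exact: replace_shift_term.
  rewrite /comp_sym /up_sym; case: (l' f) => //= u.
  by rewrite replace_shift_term.
elim: A k s k' s' => //= [P a|A IA B IB|A IA B IB|A IA B IB|A IA|A IA] k s k' s';
  rewrite ?IA ?IB ?up_comp //.
by congr Atom; apply/ffunP=> i; rewrite !ffunE replace_term_comp.
Qed.

Lemma replace_inst k s A t :
  replace k s (inst A t) =
  inst (replace (up_sym k) (up s) A) (replace_term k s t).
Proof.
rewrite /inst -!replace_no_sym !replace_comp.
(* The instantiating substitution undoes a shift. *)
have unshift u v : replace_term no_sym
    (fun x => if x is y.+1 then Var y else v) (shift_term u) = u.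
  rewrite /shift_term -replace_term_no_sym replace_term_comp -[RHS]replace_term_id.
  exact: eq_replace_term.
apply: eq_replace => [f|[|x] _] //=.
by rewrite /comp_sym /up_sym; case: (k f) => //= u; rewrite unshift.
Qed.

(** * Fresh variables and fresh constants *)

Lemma term_var_bound t : exists n, forall x, n <= x -> ~~ free_in_term x t.
Proof.
elim/term_nested_ind: t => [n|f a /fin_all_exists[b bP]] /=.
  by exists n.+1 => x; rewrite neq_ltn orbC => ->.
exists (\max_i b i) => x bx; apply/hasPn=> i _; apply: bP.
by apply: leq_trans bx; apply: leq_bigmax.
Qed.

Lemma form_var_bound A : exists n, forall x, n <= x -> ~~ free_in x A.
Proof.
elim: A => [P a|||A [n nP] B [m mP]|A [n nP] B [m mP]|A [n nP] B [m mP]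
           |A [n nP]|A [n nP]] /=; try by exists 0.
- have /fin_all_exists[b bP] := fun i => term_var_bound (a i).
  exists (\max_i b i) => x bx; apply/existsPn=> i; apply: bP.
  by apply: leq_trans bx; apply: leq_bigmax.
- exists (maxn n m) => x; rewrite geq_max negb_or => /andP[nx mx].
  by rewrite nP ?mP.
- exists (maxn n m) => x; rewrite geq_max negb_or => /andP[nx mx].
  by rewrite nP ?mP.
- exists (maxn n m) => x; rewrite geq_max negb_or => /andP[nx mx].
  by rewrite nP ?mP.
- by exists n => x nx; apply: nP; apply: leqW.
- by exists n => x nx; apply: nP; apply: leqW.
Qed.

Lemma fresh_var A (G D : ctx L) :
  exists x, [/\ fresh_for x G, ~~ free_in x A & fresh_for x D].
Proof.
have bounded (l : seq (form L)) :
    exists n, forall x, n <= x -> forall B, B \in l -> ~~ free_in x B.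
  elim: l => [|B l [n nP]]; first by exists 0.
  have [m mP] := form_var_bound B.
  exists (maxn m n) => x; rewrite geq_max => /andP[mx nx] C.
  by rewrite inE => /predU1P[-> | /(nP x nx)//]; apply: mP.
have [n nP] := bounded (A :: enum_fset G ++ enum_fset D).
exists n; split=> [B BG||B BD]; apply: (nP n (leqnn n)).
- by rewrite inE mem_cat BG orbT.
- exact: mem_head.
- by rewrite inE mem_cat BD !orbT.
Qed.

(** The list stands for the symbols that occur in [t]. The only property of
    occurrence that matters is that replacement may ignore other symbols. *)
Lemma term_support t : exists l : seq (fun_sym L), forall k s,
  (forall f, f \in l -> k f = None) -> replace_term k s t = replace_term no_sym s t.
Proof.
elim/term_nested_ind: t => [n|f a /fin_all_exists[b bP]] /=; first by exists [::].
exists (f :: flatten (codom b)) => k s kl; rewrite kl ?mem_head //.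
congr App; apply/ffunP=> i; rewrite !ffunE; apply: bP => g gi; apply: kl.
rewrite inE; apply/orP; right; apply/flattenP.
by exists (b i); first exact: codom_f.
Qed.

Lemma form_support A : exists l : seq (fun_sym L), forall k s,
  (forall f, f \in l -> k f = None) -> replace k s A = replace no_sym s A.
Proof.
elim: A => [P a|||A [l lP] B [m mP]|A [l lP] B [m mP]|A [l lP] B [m mP]
           |A [l lP]|A [l lP]] /=; try by exists [::].
- have /fin_all_exists[b bP] := fun i => term_support (a i).
  exists (flatten (codom b)) => k s kl.
  congr Atom; apply/ffunP=> i; rewrite !ffunE; apply: bP => g gi; apply: kl.
  by apply/flattenP; exists (b i); first exact: codom_f.
- by exists (l ++ m) => k s kl; rewrite lP ?mP // => f fl; apply: kl;
    rewrite mem_cat fl ?orbT.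
- by exists (l ++ m) => k s kl; rewrite lP ?mP // => f fl; apply: kl;
    rewrite mem_cat fl ?orbT.
- by exists (l ++ m) => k s kl; rewrite lP ?mP // => f fl; apply: kl;
    rewrite mem_cat fl ?orbT.
- by exists l => k s kl; rewrite lP // => f fl; rewrite /up_sym kl.
- by exists l => k s kl; rewrite lP // => f fl; rewrite /up_sym kl.
Qed.

Definition constant_to (c : fun_sym L) u : fun_sym L -> option (term L) :=
  fun f => if f == c then Some u else None.

(** As in [form_support], freshness of [c] is expressed by its effect. *)
Definition fresh_sym (c : fun_sym L) A :=
  forall u s, replace (constant_to c u) s A = replace no_sym s A.

Lemma fresh_constant (A : form L) (G D : ctx L) :
  infinitely_many_constants L -> exists c : fun_sym L,
  [/\ fun_arity c = 0, forall B, B \in G -> fresh_sym c B, fresh_sym c A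
    & forall B, B \in D -> fresh_sym c B].
Proof.
move=> inf.
have support (l : seq (form L)) : exists m : seq (fun_sym L),
    forall c, c \notin m -> forall B, B \in l -> fresh_sym c B.
  elim: l => [|B l [m mP]]; first by exists [::].
  have [n nP] := form_support B.
  exists (n ++ m) => c; rewrite mem_cat negb_or => /andP[cn cm] C.
  rewrite inE => /predU1P[->|/(mP c cm)//] u s; apply: nP => f fn.
  by rewrite /constant_to; case: eqP => // fc; rewrite -fc fn in cn.
have [m mP] := support (A :: enum_fset G ++ enum_fset D).
have [c c0 cm] := inf m.
exists c; split=> // [B BG||B BD]; apply: (mP c cm).
- by rewrite inE mem_cat BG orbT.
- exact: mem_head.
- by rewrite inE mem_cat BD !orbT.
Qed.

(** * Transformations of cut-free derivations *)

Lemma deriv_AxL (G D : ctx L) A : A \in D ->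
  exists p : deriv (SeqL G A D), cutfree p /\ ends_with_axiom p.
Proof. by move=> AD; rewrite -(mem_fset1U AD); exists (AxL G A D). Qed.

Lemma deriv_AxR (G D : ctx L) A : A \in G ->
  exists p : deriv (SeqR G A D), cutfree p /\ ends_with_axiom p.
Proof. by move=> AG; rewrite -(mem_fset1U AG); exists (AxR G A D). Qed.

(** What (Cut) inspects in its premises. *)
Definition last_rule S (p : deriv S) := (@ends_with_axiom L S p, ends_with_intro p).

Lemma normal_cut_last_rule S S' T T' (p : @deriv L S) (p' : deriv S')
    (q : @deriv L T) (q' : deriv T') :
    last_rule p' = last_rule p -> last_rule q' = last_rule q ->
  normal_cut p' q' = normal_cut p q.
Proof. by rewrite /normal_cut => -[-> ->] [-> ->]. Qed.

Definition replace_sub k s (G G' : ctx L) :=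
  forall B, B \in G -> replace k s B \in G'.

Definition replaced_sequent k s (S S' : sequent L) : Prop :=
  match S, S' with
  | Seq G D, Seq G' D' => replace_sub k s G G' /\ replace_sub k s D D'
  | SeqL G A D, SeqL G' A' D' =>
      [/\ replace_sub k s G G', A' = replace k s A & replace_sub k s D D']
  | SeqR G A D, SeqR G' A' D' =>
      [/\ replace_sub k s G G', A' = replace k s A & replace_sub k s D D']
  | _, _ => False
  end.

Lemma replace_sub1U k s A (G G' : ctx L) : replace_sub k s G G' ->
  replace_sub k s (A |` G) (replace k s A |` G').
Proof.
by move=> GG' B /fset1UP[->|/GG' BG']; rewrite ?fset1U1 // fset1Ur.
Qed.

(** The body of a quantified formula is replaced with the eigenvariable [x]
    renamed to [y], and the rest of the sequent does not notice the renaming,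
    as [x] is fresh for it. *)
Lemma replace_eigenvar k s x y A :
    ~~ free_in x.+1 A ->
  inst (replace (up_sym k) (up s) A) (Var y) =
  replace k (fun z => if z == x then Var y else s z) (inst A (Var x)).
Proof.
move=> xA; rewrite replace_inst /= eqxx; congr inst.
apply: eq_replace => // -[|z] //= zA.
by case: eqP => // zx; rewrite -zx zA in xA.
Qed.

Lemma replace_sub_eigenvar k s x y (G G' : ctx L) :
    fresh_for x G -> replace_sub k s G G' ->
  replace_sub k (fun z => if z == x then Var y else s z) G G'.
Proof.
move=> xG GG' B BG; rewrite (eq_replace (k' := k) (s' := s)) ?GG' // => z zB.
by case: eqP => // zx; have := xG B BG; rewrite -zx zB.
Qed.

(** Replacement and weakening are done together because both force the
    eigenvariables to be renamed, and a renaming is a replacement again. Last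
    rules are preserved so that normal cuts remain normal. *)
Lemma deriv_replace S (p : deriv S) : cutfree p ->
  forall k s S', replaced_sequent k s S S' ->
  exists p' : deriv S', cutfree p' /\ last_rule p' = last_rule p.
Proof.
elim: S / p => [G A D|G A D|G A D p IH|G A D p IH|G A B D p IHp q IHq
  |G A B D p IH|G A B D p IHp q IHq|G A B D p IH|G A B D p IH|G A B D p IH
  |G A B D p IH|G A B D p IHp q IHq|x G A D xG xA xD p IH|t G A D p IH
  |t G A D p IH|x G A D xG xA xD p IH|G D|G D|G A D p IHp q IHq] /= cf k s
  [G' D'|G' A' D'|G' A' D'] //= => [[GG' -> DD']|[GG' -> DD']|[GG' -> DD']
  |[GG' -> DD']|[GG' -> DD']|[GG' -> DD']|[GG' -> DD']|[GG' -> DD']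
  |[GG' -> DD']|[GG' -> DD']|[GG' -> DD']|[GG' -> DD']|[GG' -> DD']
  |[GG' -> DD']|[GG' -> DD']|[GG' -> DD']|[GG' -> DD']|[GG' -> DD']
  |[GG' DD']].
- have AD' : replace k s A \in D' by apply: DD'; rewrite fset1U1.
  by rewrite -(mem_fset1U AD'); exists (AxL _ _ _).
- have AG' : replace k s A \in G' by apply: GG'; rewrite fset1U1.
  by rewrite -(mem_fset1U AG'); exists (AxR _ _ _).
- have [|p' [cf' _]] := IH cf k s (Seq (replace k s A |` G') D').
    by split=> //; apply: replace_sub1U.
  by exists (MuT p').
- have [|p' [cf' _]] := IH cf k s (Seq G' (replace k s A |` D')).
    by split=> //; apply: replace_sub1U.
  by exists (Mu p').
- case/andP: cf => cfp cfq.
  have [//|p' [cfp' _]] := IHp cfp k s (SeqR G' (replace k s A) D').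
  have [//|q' [cfq' _]] := IHq cfq k s (SeqL G' (replace k s B) D').
  by exists (ImpL p' q'); rewrite /= cfp'.
- have [|p' [cf' _]] :=
    IH cf k s (SeqR (replace k s A |` G') (replace k s B) D').
    by split=> //; apply: replace_sub1U.
  by exists (ImpR p').
- case/andP: cf => cfp cfq.
  have [//|p' [cfp' _]] := IHp cfp k s (SeqL G' (replace k s A) D').
  have [//|q' [cfq' _]] := IHq cfq k s (SeqL G' (replace k s B) D').
  by exists (OrL p' q'); rewrite /= cfp'.
- have [//|p' [cf' _]] := IH cf k s (SeqR G' (replace k s A) D').
  by exists (OrR1 _ p').
- have [//|p' [cf' _]] := IH cf k s (SeqR G' (replace k s B) D').
  by exists (OrR2 _ p').
- have [//|p' [cf' _]] := IH cf k s (SeqL G' (replace k s A) D').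
  by exists (AndL1 _ p').
- have [//|p' [cf' _]] := IH cf k s (SeqL G' (replace k s B) D').
  by exists (AndL2 _ p').
- case/andP: cf => cfp cfq.
  have [//|p' [cfp' _]] := IHp cfp k s (SeqR G' (replace k s A) D').
  have [//|q' [cfq' _]] := IHq cfq k s (SeqR G' (replace k s B) D').
  by exists (AndR p' q'); rewrite /= cfp'.
- have [y [yG yA yD]] := fresh_var (replace k s (Ex A)) G' D'.
  have [|p' [cf' _]] := IH cf k (fun z => if z == x then Var y else s z)
      (SeqL G' (inst (replace (up_sym k) (up s) A) (Var y)) D').
    by split; [exact: replace_sub_eigenvar | exact: replace_eigenvar
              | exact: replace_sub_eigenvar].
  by exists (ExL yG yA yD p').
- have [|p' [cf' _]] := IH cf k s
    (SeqR G' (inst (replace (up_sym k) (up s) A) (replace_term k s t)) D').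
    by rewrite /= replace_inst.
  by exists (ExR p').
- have [|p' [cf' _]] := IH cf k s
    (SeqL G' (inst (replace (up_sym k) (up s) A) (replace_term k s t)) D').
    by rewrite /= replace_inst.
  by exists (AllL p').
- have [y [yG yA yD]] := fresh_var (replace k s (All A)) G' D'.
  have [|p' [cf' _]] := IH cf k (fun z => if z == x then Var y else s z)
      (SeqR G' (inst (replace (up_sym k) (up s) A) (Var y)) D').
    by split; [exact: replace_sub_eigenvar | exact: replace_eigenvar
              | exact: replace_sub_eigenvar].
  by exists (AllR yG yA yD p').
- by exists (BotL G' D').
- by exists (TopR G' D').
- case/and3P: cf => ncut cfp cfq.
  have [//|p' [cfp' lp]] := IHp cfp k s (SeqR G' (replace k s A) D').
  have [//|q' [cfq' lq]] := IHq cfq k s (SeqL G' (replace k s A) D').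
  exists (Cut p' q'); split=> //=.
  by rewrite (normal_cut_last_rule lp lq) ncut cfp'.
Qed.

Lemma cutfree_replace k s S S' : replaced_sequent k s S S' ->
  cutfree_derivable S -> cutfree_derivable S'.
Proof.
by move=> SS' [p cf]; have [p' [cf' _]] := deriv_replace cf SS'; exists p'.
Qed.

Lemma replace_sub_id (G G' : ctx L) : G `<=` G' -> replace_sub no_sym Var G G'.
Proof. by move=> /fsubsetP GG' B; rewrite replace_id => /GG'. Qed.

Lemma weaken_left (G D G' D' : ctx L) A : G `<=` G' -> D `<=` D' ->
  cutfree_derivable (SeqL G A D) -> cutfree_derivable (SeqL G' A D').
Proof.
by move=> GG' DD'; apply: (@cutfree_replace no_sym Var);
  split; rewrite ?replace_id //; apply: replace_sub_id.
Qed.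

Lemma replace_fresh_sym c u A :
  fresh_sym c A -> replace (constant_to c u) Var A = A.
Proof. by move=> cA; rewrite cA replace_id. Qed.

Lemma replace_sub_fresh_sym c u (G : ctx L) :
    (forall B, B \in G -> fresh_sym c B) ->
  replace_sub (constant_to c u) Var G G.
Proof. by move=> cG B BG; rewrite replace_fresh_sym //; apply: cG. Qed.

Lemma inst_fresh_constant c u A (a : {ffun 'I_(fun_arity c) -> term L}) :
    fresh_sym c A ->
  inst A u = replace (constant_to c u) Var (inst A (App a)).
Proof.
move=> cA; rewrite replace_inst /= /constant_to eqxx; congr inst.
rewrite -[LHS](replace_fresh_sym (shift_term u) cA); apply: eq_replace.
  by move=> f; rewrite /up_sym /constant_to; case: eqP.
by case.
Qed.

Lemma cutfree_last_rule S (p : @deriv L S) : cutfree p ->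
  ends_with_axiom p || ends_with_intro p \/
  match S with
  | Seq G D => True
  | SeqL G A D => cutfree_derivable (Seq (A |` G) D)
  | SeqR G A D => cutfree_derivable (Seq G (A |` D))
  end.
Proof.
by case: S / p => *; try (by left); right => //; eexists; eassumption.
Qed.

(** This is a cut against an axiom. It would not be normal if the derivation
    ended with (mu~), but then the premise of (mu~) is already the sequent
    [G |- D], because [A] belongs to [G]. *)
Lemma explode_left (G D : ctx L) A : A \in G ->
  cutfree_derivable (SeqL G A D) -> cutfree_derivable (Seq G D).
Proof.
move=> AG [p cfp]; have [pP|] := cutfree_last_rule cfp; last first.
  by rewrite (mem_fset1U AG).
have [q [cfq axq]] := deriv_AxR D AG.
by exists (Cut q p); rewrite /= /normal_cut axq pP cfq cfp.
Qed.

Lemma explode_right (G D : ctx L) A : A \in D ->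
  cutfree_derivable (SeqR G A D) -> cutfree_derivable (Seq G D).
Proof.
move=> AD [p cfp]; have [pP|] := cutfree_last_rule cfp; last first.
  by rewrite (mem_fset1U AD).
have [q [cfq axq]] := deriv_AxL G AD.
by exists (Cut p q); rewrite /= /normal_cut axq pP cfq cfp orbT.
Qed.

(** * Completeness of the universal model *)

Implicit Type w : world L.

Lemma wle_refl w : wle w w.
Proof. by split. Qed.

Lemma wle_trans w1 w2 w3 : wle w1 w2 -> wle w2 w3 -> wle w1 w3.
Proof.
by move=> [l1 r1] [l2 r2]; split; [exact: fsubset_trans l2
                                  | exact: fsubset_trans r2].
Qed.

Lemma forced_mono w w' A : wle w w' -> forced w A -> forced w' A.
Proof. by move=> ww' F v w'v; apply: F; apply: wle_trans w'v. Qed.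

Lemma refuted_mono w w' A : wle w w' -> refuted w A -> refuted w' A.
Proof. by move=> ww' F v w'v; apply: F; apply: wle_trans w'v. Qed.

Lemma srefuted_mono w w' A : wle w w' -> srefuted w A -> srefuted w' A.
Proof.
move=> ww'; case: A => [P a|||A B|A B|A B|A|A].
- by case: ww' => GG' DD' /srefuted_AtomE X; apply/srefuted_AtomE;
    apply: weaken_left X.
- by [].
- by [].
- by move=> /srefuted_AndE H; apply/srefuted_AndE; case: H => /(refuted_mono ww');
    [left | right].
- move=> /srefuted_OrE[/(refuted_mono ww') ? /(refuted_mono ww') ?].
  exact/srefuted_OrE.
- move=> /srefuted_ImpE[/(forced_mono ww') ? /(refuted_mono ww') ?].
  exact/srefuted_ImpE.
- move=> /srefuted_ExE F; apply/srefuted_ExE => v d w'v.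
  by apply: F; apply: wle_trans w'v.
- move=> /srefuted_AllE[d [wd /(refuted_mono ww') ?]].
  by apply/srefuted_AllE; exists d.
Qed.

Lemma srefuted_refuted w A : srefuted w A -> refuted w A.
Proof.
by move=> sA v wv vA; apply: vA (wle_refl v) _; apply: srefuted_mono sA.
Qed.

Definition reify_forced A := forall w, forced w A ->
  cutfree_derivable (SeqR w.1 A w.2).
Definition reify_refuted A := forall w, refuted w A ->
  cutfree_derivable (SeqL w.1 A w.2).
Definition reify_srefuted A := forall w, srefuted w A ->
  cutfree_derivable (SeqL w.1 A w.2).

Lemma forced_hyp A w : reify_srefuted A -> A \in w.1 -> forced w A.
Proof.
move=> rA Aw v [wv _] vA; apply: (explode_left (A := A)); last exact: rA.
exact: (fsubsetP wv).
Qed.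

Lemma reify_srefuted_refuted A : reify_srefuted A -> reify_refuted A.
Proof.
move=> rA w F; have [] := F (A |` w.1, w.2).
- by split=> //=; apply: fsubsetU1.
- by apply: forced_hyp => //=; rewrite fset1U1.
- by move=> p cfp; exists (MuT p).
Qed.

(** Dual to [forced_hyp]; it is what makes [Or] and [Ex] strongly refuted once
    they are in the right context. *)
Lemma refuted_concl A w :
    (forall v, wle w v -> forced v A -> exists2 B,
       B \in w.2 & cutfree_derivable (SeqR v.1 B v.2)) ->
  refuted w A.
Proof.
move=> rA v wv vA; have [B Bw] := rA v wv vA; apply: explode_right.
by case: wv => _ /fsubsetP; apply.
Qed.

Lemma forced_explode A w : forced w A -> srefuted (w.1, A |` w.2) A ->
  cutfree_derivable (SeqR w.1 A w.2).
Proof.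
move=> F /F[|p cfp]; first by split=> //=; apply: fsubsetU1.
by exists (Mu p).
Qed.

Lemma closed_constant (c : fun_sym L) : fun_arity c = 0 ->
  closed_term (App [ffun i : 'I_(fun_arity c) => Var 0]).
Proof.
move=> c0 x; apply/hasPn => -[i ic].
by exfalso; have := ic; rewrite [X in _ < X]c0.
Qed.

Lemma reify A : infinitely_many_constants L ->
  reify_forced A /\ reify_srefuted A.
Proof.
move=> inf.
have [n] := ubnP (height A); elim: n A => // n IHn A; rewrite ltnS => hA.
(* Height, unlike the subformula order, makes [inst A d] smaller than [Ex A]. *)
have {hA}IH B : height B < height A ->
    [/\ reify_forced B, reify_refuted B & reify_srefuted B].
  move=> BA; have [] := IHn B (leq_trans BA hA).
  by split=> //; apply: reify_srefuted_refuted.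
clear n IHn; case: A IH => [P a|||A B|A B|A B|A|A] /= IH.
- split=> w //; move=> F; apply: forced_explode => //.
  apply/srefuted_AtomE => /=.
  by have [|p []] := @deriv_AxL w.1 (Atom a |` w.2) (Atom a);
    [rewrite fset1U1 | exists p].
- by split=> w // _; exists (TopR w.1 w.2).
- split=> w; last by exists (BotL w.1 w.2).
  by move=> F; apply: forced_explode.
- have [|fA rA sA] := IH A; first by rewrite ltnS leq_maxl.
  have [|fB rB sB] := IH B; first by rewrite ltnS leq_maxr.
  split=> w.
    move=> F.
    have [|p cfp] := fA w.
      move=> v wv /srefuted_refuted vA; apply: F => //.
      by apply/srefuted_AndE; left.
    have [|q cfq] := fB w.
      move=> v wv /srefuted_refuted vB; apply: F => //.
      by apply/srefuted_AndE; right.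
    by exists (AndR p q); rewrite /= cfp.
  by move=> /srefuted_AndE[/rA|/rB] [p cfp];
    [exists (AndL1 _ p) | exists (AndL2 _ p)].
- have [|fA rA sA] := IH A; first by rewrite ltnS leq_maxl.
  have [|fB rB sB] := IH B; first by rewrite ltnS leq_maxr.
  split=> w.
    move=> F; apply: forced_explode => //; apply/srefuted_OrE.
    split; apply: refuted_concl => v _.
      move=> /fA[p cfp]; exists (Or A B); last by exists (OrR1 _ p).
      by rewrite fset1U1.
    move=> /fB[p cfp]; exists (Or A B); last by exists (OrR2 _ p).
    by rewrite fset1U1.
  move=> /srefuted_OrE[/rA[p cfp] /rB[q cfq]].
  by exists (OrL p q); rewrite /= cfp.
- have [|fA rA sA] := IH A; first by rewrite ltnS leq_maxl.
  have [|fB rB sB] := IH B; first by rewrite ltnS leq_maxr.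
  split=> w.
    move=> F; have [|p cfp] := fB (A |` w.1, w.2); last by exists (ImpR p).
    move=> v wv /srefuted_refuted vB; apply: F.
      by apply: wle_trans wv; split=> //=; apply: fsubsetU1.
    apply/srefuted_ImpE; split=> //; apply: forced_hyp => //.
    by case: wv => /fsubsetP/(_ A); rewrite fset1U1 => /(_ isT).
  move=> /srefuted_ImpE[/fA[p cfp] /rB[q cfq]].
  by exists (ImpL p q); rewrite /= cfp.
- have {}IH d : [/\ reify_forced (inst A d), reify_refuted (inst A d)
                  & reify_srefuted (inst A d)].
    by apply: IH; rewrite height_inst.
  split=> w.
    move=> F; apply: forced_explode => //; apply/srefuted_ExE => v d wv _.
    apply: refuted_concl => u vu; have [fA _ _] := IH d => /fA[p cfp].
    exists (Ex A); last by exists (ExR p).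
    by case: wv => _ /fsubsetP; apply; rewrite fset1U1.
  move=> /srefuted_ExE F.
  have [c [c0 cG cA cD]] := fresh_constant A w.1 w.2 inf.
  have [x [xG xA xD]] := fresh_var (Ex A) w.1 w.2.
  have [_ rA _] := IH (App [ffun i : 'I_(fun_arity c) => Var 0]).
  have := rA w (F w _ (wle_refl w) (closed_constant c0)).
  move=> /(@cutfree_replace (constant_to c (Var x)) Var _
            (SeqL w.1 (inst A (Var x)) w.2))[|p cfp].
    by split; [exact: replace_sub_fresh_sym | exact: inst_fresh_constant
              | exact: replace_sub_fresh_sym].
  by exists (ExL xG xA xD p).
- have {}IH d : [/\ reify_forced (inst A d), reify_refuted (inst A d)
                  & reify_srefuted (inst A d)].
    by apply: IH; rewrite height_inst.
  split=> w; last first.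
    move=> /srefuted_AllE[d [_]]; have [_ rA _] := IH d => /rA[p cfp].
    by exists (AllL p).
  move=> F.
  have [c [c0 cG cA cD]] := fresh_constant A w.1 w.2 inf.
  have [x [xG xA xD]] := fresh_var (All A) w.1 w.2.
  have [fA _ _] := IH (App [ffun i : 'I_(fun_arity c) => Var 0]).
  have /fA : forced w (inst A (App [ffun i : 'I_(fun_arity c) => Var 0])).
    move=> v wv /srefuted_refuted vA; apply: F => //.
    by apply/srefuted_AllE; exists (App [ffun i : 'I_(fun_arity c) => Var 0]);
      split=> //; apply: closed_constant.
  move=> /(@cutfree_replace (constant_to c (Var x)) Var _
            (SeqR w.1 (inst A (Var x)) w.2))[|p cfp].
    by split; [exact: replace_sub_fresh_sym | exact: inst_fresh_constant
              | exact: replace_sub_fresh_sym].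
  by exists (AllR xG xA xD p).
Qed.

End Replacement.

Theorem theorem17 (L : language) (hL : infinitely_many_constants L)
    (A : form L) (Gamma Delta : ctx L)
    (hA : sentence A)
    (hGamma : forall B : form L, B \in Gamma -> sentence B)
    (hDelta : forall B : form L, B \in Delta -> sentence B) :
  (forced (Gamma, Delta) A ->
     exists p : deriv (SeqR Gamma A Delta), cutfree p) /\
  (refuted (Gamma, Delta) A ->
     exists p : deriv (SeqL Gamma A Delta), cutfree p).
Proof.
have [fA sA] := reify A hL.
by split=> [/fA|/(reify_srefuted_refuted sA)].
Qed.
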